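(* Let $\pi:(X,T)\to(Y,S)$ be a factor map between dynamical systems. If $\mathrm{mdim}(Y,S)=0$ then $$\mathrm{mdim}(X,T)=\mathrm{mdim}(\pi,T).$$
   Context: ''Simplicial complex'' always means a finite simplicial complex (identified with its geometric realization). For a metric space $(X,d)$, a topological space $Y$ and $\varepsilon>0$, a continuous map $f:X\to Y$ is an $\varepsilon$-embedding if $\mathrm{Diam}\, f^{-1}(y)<\varepsilon$ for all $y\in Y$. The $\varepsilon$-width dimension $\mathrm{Widim}_\varepsilon(X,d)$ is the minimum integer $n\ge 0$ such that there exist an $n$-dimensional simplicial complex $P$ and an $\varepsilon$-embedding $f:X\to P$. Subsets of metric spaces carry the restricted metric. A dynamical system $(X,T)$ is a compact metrizable space $X$ with a homeomorphism $T:X\to X$. Given a metric $d$ on $X$ compatible with the topology, for each natural number $N$ set $d_N(x,y)=\max_{0\le n<N} d(T^nx,T^ny)$. The mean dimension is $$\mathrm{mdim}(X,T)=\lim_{\varepsilon\to 0}\left(\lim_{N\to\infty}\frac{\mathrm{Widim}_\varepsilon(X,d_N)}{N}\right)\in[0,\infty],$$ which is independent of the choice of $d$. A factor map $\pi:(X,T)\to(Y,S)$ between dynamical systems is a continuous surjection $\pi:X\to Y$ with $\pi\circ T=S\circ\pi$. Its relative mean dimension is $$\mathrm{mdim}(\pi,T)=\lim_{\varepsilon\to 0}\left(\lim_{N\to\infty}\frac{\sup_{y\in Y}\mathrm{Widim}_\varepsilon(\pi^{-1}(y),d_N)}{N}\right)\in[0,\infty]$$ (the limits exist by subadditivity in $N$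 and monotonicity in $\varepsilon$). *)

(* Defs.v *)
From HB Require Import structures.
From mathcomp Require Import all_boot all_order all_algebra.
From mathcomp Require Import all_classical all_reals all_analysis.

Set Implicit Arguments.
Unset Strict Implicit.
Unset Printing Implicit Defensive.

Import Order.TTheory GRing.Theory Num.Theory.
Import numFieldTopology.Exports numFieldNormedType.Exports.

Local Open Scope classical_set_scope.
Local Open Scope ring_scope.

(* Finite abstract simplicial complexes with vertices among 0, ..., m-1.  Not
   every i : 'I_m has to be a vertex; i is one iff the singleton is a simplex. *)
Record simplicial_complex (m : nat) := SimplicialComplex {
  simplices : {set {set 'I_m}} ;
  simplices_neq0 : forall s, s \in simplices -> s != finset.set0 ;
  simplices_face : forall s t : {set 'I_m},
    s \in simplices -> t != finset.set0 -> t \subset s -> t \in simplices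
}.

Definition complex_dim (m : nat) (K : simplicial_complex m) (n : nat) : Prop :=
  (exists2 s, s \in simplices K & #|s| = n.+1) /\
  (forall s, s \in simplices K -> (#|s| <= n.+1)%N).

(* The i-th vertex is sent to the i-th basis vector of R^m, and p is given by
   its barycentric coordinates. *)
Definition realization (R : realType) (m : nat) (K : simplicial_complex m) :
    set 'rV[R]_m :=
  [set p : 'rV[R]_m | [/\ forall i, 0 <= p 0 i,
                          \sum_i p 0 i = 1 &
                          finset (fun i => p 0 i != 0) \in simplices K]].

(* Supremum computed in [0, +oo], so that the supremum of the empty set is 0. *)
Definition ereal_sup0 (R : realType) (A : set (\bar R)) : \bar R :=
  ereal_sup ([set 0%E] `|` A).

Definition diam (R : realType) (X : Type) (d : X -> X -> R) (A : set X) :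
    \bar R :=
  ereal_sup0 [set (d p.1 p.2)%:E | p in A `*` A].

(* [f] restricted to the subspace [A] of [X] is an [e]-embedding of the metric
   space [(A, d)] into the subspace [P] of [Z].  Here [d] is a metric inducing
   the topology of [X]. *)
Definition eps_embedding (R : realType) (X Z : topologicalType)
    (d : X -> X -> R) (e : R) (A : set X) (P : set Z) (f : X -> Z) : Prop :=
  [/\ {within A, continuous f},
      set_fun A P f &
      forall z, P z -> (diam d (A `&` f @^-1` [set z]) < e%:E)%E].

(* An infimum of natural numbers in \bar R, hence a minimum as soon as some n
   qualifies (and +oo otherwise). *)
Definition Widim (R : realType) (X : topologicalType) (d : X -> X -> R) (e : R)
    (A : set X) : \bar R :=
  ereal_inf [set n%:R%:E | n in [set n : nat |
    exists (m : nat) (K : simplicial_complex m) (f : X -> 'rV[R]_m),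
      complex_dim K n /\ eps_embedding d e A (realization K) f]].

Definition homeomorphism (X : topologicalType) (T : X -> X) : Prop :=
  exists T' : X -> X,
    [/\ continuous T, continuous T', cancel T T' & cancel T' T].

(* The metric structure of X plays the role of the chosen compatible metric. *)
Definition dynamical_system (R : realType) (X : metricType R) (T : X -> X) :
    Prop :=
  compact [set: X] /\ homeomorphism T.

Definition dyn_dist (R : realType) (X : metricType R) (T : X -> X) (N : nat)
    (x y : X) : R :=
  \big[Num.max/0]_(n < N) mdist (iter n T x) (iter n T y).

Definition mdim (R : realType) (X : metricType R) (T : X -> X) : \bar R :=
  lim (lim ((Widim (dyn_dist T N) e [set: X] / N%:R%:E)%E @[N --> \oo])
    @[e --> (0 : R)^'+]).

Definition factor_map (X Y : topologicalType) (T : X -> X) (S : Y -> Y)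
    (pi : X -> Y) : Prop :=
  [/\ continuous pi, set_surj [set: X] [set: Y] pi & pi \o T = S \o pi].

Definition rel_mdim (R : realType) (X : metricType R) (Y : topologicalType)
    (T : X -> X) (pi : X -> Y) : \bar R :=
  lim (lim ((ereal_sup0
               [set Widim (dyn_dist T N) e (pi @^-1` [set y]) | y in [set: Y]]
             / N%:R%:E)%E @[N --> \oo])
    @[e --> (0 : R)^'+]).

(* Main.v *)
Require Import Defs.
From mathcomp Require Import all_boot all_order all_algebra.
From mathcomp Require Import all_classical all_reals all_analysis.
From mathcomp Require Import lra zify.

Set Implicit Arguments.
Unset Strict Implicit.
Unset Printing Implicit Defensive.

Import Order.TTheory GRing.Theory Num.Theory.
Import numFieldTopology.Exports numFieldNormedType.Exports.

Local Open Scope classical_set_scope.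
Local Open Scope ring_scope.

(* Fix e and N, and let every fiber of pi embed with d_N-diameters < e in a
   complex of dimension k.  These maps extend to charts near the fibers, over
   finitely many open sets U_i covering Y.  For M large, mdim S = 0 gives a
   partition of unity on Y of order o(M) whose supports are small for d_M, so
   that at each time jN < M a support lies in some U_i.  Cutting [0, J], with
   J ~ M / N, into intervals of lengths proportional to the values of the
   partition of unity at y, one uses at time jN the chart of the function whose
   interval contains [j, j + 1], and interpolates for the o(M) exceptional j.
   Hence X embeds in dimension J (k + 1) + o(M), that is, for each fixed e the
   upper mean growth of Widim_e of X is at most (r_N + 1) / N for every N, where
   r_N is the supremum over the fibers.  As r_N is at most Widim_e (X, d_N), both
   inner limits exist and agree.

   Dimensions are counted with cubical maps, i.e., nonnegative real coordinates
   of which at most D are not integers at any point: these concatenate without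
   triangulating products, and the Kuhn triangulation of R^I turns them into
   maps to a D-dimensional complex. *)

(** * Uniform estimates from compactness *)

Section Compactness.
Context {R : realType}.

Lemma continuous_bigmax (X : topologicalType) (I : Type) (r : seq I)
    (c : R) (F : I -> X -> R) :
  (forall i, continuous (F i)) ->
  continuous (fun x => \big[Num.max/c]_(i <- r) F i x).
Proof.
move=> cF; elim: r => [|i r IH] x.
  under eq_fun do rewrite big_nil; exact: cvg_cst.
under eq_fun do rewrite big_cons.
by apply: (@continuous_max R _ (F i)); [exact: cF|exact: IH].
Qed.

Lemma continuous_bigmin (X : topologicalType) (I : Type) (r : seq I)
    (c : R) (F : I -> X -> R) :
  (forall i, continuous (F i)) ->
  continuous (fun x => \big[Num.min/c]_(i <- r) F i x).
Proof.
move=> cF; elim: r => [|i r IH] x.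
  under eq_fun do rewrite big_nil; exact: cvg_cst.
under eq_fun do rewrite big_cons.
by apply: (@continuous_min R _ (F i)); [exact: cF|exact: IH].
Qed.

Lemma compact_lt_uniform (T : topologicalType) (K : set T) (h : T -> R)
    (e : R) :
  compact K -> continuous h -> (forall x, K x -> h x < e) ->
  exists2 e', e' < e & forall x, K x -> h x <= e'.
Proof.
move=> cK ch hlt; have [K0|/set0P K0] := eqVneq K set0.
  by exists (e - 1) => [|x]; [lra|rewrite K0].
have [c /set_mem Kc cmax] := compact_EVT_max K0 cK (continuous_subspaceT ch).
by exists (h c); [exact: hlt|move=> x Kx; apply/cmax/mem_set].
Qed.

Lemma closed_le_fun (T : topologicalType) (h g : T -> R) :
  continuous h -> continuous g -> closed [set x | h x <= g x].
Proof.
move=> ch cg; have -> : [set x | h x <= g x] = (h \- g) @^-1` [set y | y <= 0].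
  by apply/seteqP; split=> x /=; rewrite subr_le0.
apply: preimage_closed; last exact: closed_le.
by move=> x _; apply: cvgB; [exact: ch|exact: cg].
Qed.

(** Compactness of [A * A] is used twice. Over the pairs on which all [F i] agree, [d] is bounded by
    some [e0 < e]; over the pairs with [d] at least the midpoint of [e0] and [e], the largest
    difference of the [F i] is positive, hence bounded away from 0. *)
Lemma uniform_fibers (X : topologicalType) (A : set X) (d : X -> X -> R)
    (e : R) (I : finType) (F : I -> X -> R) :
  compact A -> continuous (fun p : X * X => d p.1 p.2) ->
  (forall i, continuous (F i)) ->
  (forall x x', A x -> A x' -> (forall i, F i x = F i x') -> d x x' < e) ->
  exists t, exists2 e', 0 < t /\ e' < e &
    forall x x', A x -> A x' -> (forall i, `|F i x - F i x'| <= t) ->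
      d x x' <= e'.
Proof.
move=> cA cd cF Fd.
pose h (p : X * X) : R := \big[Num.max/0]_i `|F i p.1 - F i p.2|.
have cFi (i : I) : continuous (fun p : X * X => `|F i p.1 - F i p.2|).
  move=> p; apply: cvg_norm; apply: cvgB.
    by apply: continuous_comp; [exact: cvg_fst|exact: cF].
  by apply: continuous_comp; [exact: cvg_snd|exact: cF].
have ch : continuous h by exact: continuous_bigmax.
have cAA : compact (A `*` A) by exact: compact_setX.
have [e0 e0e le0] : exists2 e0, e0 < e & forall p,
    ((A `*` A) `&` [set p | h p <= 0]) p -> d p.1 p.2 <= e0.
  apply: compact_lt_uniform => //.
    apply: compact_closedI => //.
    by apply: closed_le_fun => // p; exact: cvg_cst.
  move=> [x x'] /= [[Ax Ax'] h0]; apply: Fd => // i; apply/eqP.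
  rewrite -subr_eq0 -normr_le0; apply: le_trans h0.
  by rewrite /h/=; apply: (@le_bigmax _ _ _ 0 (fun i => `|F i x - F i x'|)).
have [t t0 lt] : exists2 t, t < 0 & forall p,
    ((A `*` A) `&` [set p | (e0 + e) / 2 <= d p.1 p.2]) p -> - h p <= t.
  apply: compact_lt_uniform => //.
  - apply: compact_closedI => //.
    by apply: closed_le_fun => // p; exact: cvg_cst.
  - by move=> p; apply: cvgN; exact: ch.
  move=> p /= [AAp dp]; rewrite oppr_lt0 ltNge; apply/negP => hp.
  by have := le0 p (conj AAp hp); lra.
exists (- t / 2), ((e0 + e) / 2); first lra.
move=> x x' Ax Ax' Fx; rewrite leNgt; apply/negP => dx.
have /= := lt (x, x') (conj (conj Ax Ax') (ltW dx)).
have : h (x, x') <= - t / 2.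
  by apply/bigmax_leP; split => // ; lra.
by move: t0; lra.
Qed.

End Compactness.

(** * Weights of the Kuhn triangulation *)

Section Kuhn.
Context {R : realType} {I : finType}.
Implicit Types (p : I -> R) (v : I -> nat).

(** When positive, this is the length of the set of [t] in [[0, 1]] for which [v] is the
    coordinatewise floor of [p + t], i.e., the barycentric weight at [p] of the vertex [v]. *)
Definition kuhn p v : R :=
  \big[Num.min/1]_i ((v i).+1%:R - p i) - \big[Num.max/0]_i ((v i)%:R - p i).

Lemma kuhn_gt0 p v : 0 < kuhn p v ->
  exists2 t, 0 < t < 1 & forall i, (v i)%:R < p i + t < (v i).+1%:R.
Proof.
rewrite /kuhn; set a := \big[Num.min/1]_i _; set b := \big[Num.max/0]_i _ => ab.
exists ((a + b) / 2) => [|i].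
  have : a <= 1 by exact: bigmin_le_id.
  have : 0 <= b by exact: bigmax_ge_id.
  by lra.
have : a <= (v i).+1%:R - p i by exact: bigmin_le.
have : (v i)%:R - p i <= b.
  by apply: (@le_bigmax _ _ _ 0 (fun i => (v i)%:R - p i)).
by lra.
Qed.

Lemma kuhn_truncn_gt0 p : (forall i, 0 <= p i) ->
  0 < kuhn p (fun i => Num.truncn (p i)).
Proof.
move=> p0; rewrite /kuhn.
rewrite subr_gt0 (@le_lt_trans _ _ 0)//.
  by apply/bigmax_leP; split => // i _; rewrite subr_le0 truncn_le.
apply/bigmin_gtP; split => // i _; rewrite subr_gt0.
by case/andP: (truncn_itv (p0 i)).
Qed.

Lemma kuhn_dist p q v i : 0 < kuhn p v -> 0 < kuhn q v -> `|p i - q i| <= 2.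
Proof.
move=> /kuhn_gt0[t t01 /(_ i) pt] /kuhn_gt0[s s01 /(_ i) qs].
by rewrite ler_norml; move: pt qs; rewrite -natr1; lra.
Qed.

(* The vertices of positive weight at p are floors of p + t, 0 < t < 1: they
   form a chain, which is parametrized by the coordinate sum. *)
Lemma card_kuhn_gt0 p (H : nat) : (forall i, 0 <= p i) ->
  (#|[set v : {ffun I -> 'I_H} | (0 < kuhn p (fun i => v i : nat))%R]%SET|
     <= #|[set i | p i \isn't a Num.nat]%SET|.+1)%N.
Proof.
move=> p0; set D := #|[set i | _]%SET|.
set A := [set v : {ffun I -> 'I_H} | _]%SET.
(* Adding [t < 1] raises the floor of a coordinate by at most one, and not at all at an integer
   coordinate. *)
have vp (v : {ffun I -> 'I_H}) i : v \in A ->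
    (Num.truncn (p i) <= v i <= Num.truncn (p i) + (p i \isn't a Num.nat))%N.
  rewrite inE => /kuhn_gt0[t t01 /(_ i)].
  have /andP[] := truncn_itv (p0 i); set n := Num.truncn (p i) => np pn vt.
  have : (n < (v i).+1)%N by rewrite -(ltr_nat R); move: np vt t01; lra.
  rewrite ltnS => -> /=.
  have [/natrP[m pm]|_] /= := boolP (p i \is a Num.nat).
    rewrite addn0; have -> : n = m by rewrite /n pm natrK.
    by rewrite -ltnS -(ltr_nat R) -natr1; move: vt; rewrite -natr1 pm; lra.
  by rewrite addn1 -ltnS -(ltr_nat R) -natr1; move: vt pn; rewrite -!natr1; lra.
pose g (v : {ffun I -> 'I_H}) := (\sum_i (v i - Num.truncn (p i)))%N.
have gD (v : {ffun I -> 'I_H}) : v \in A -> (g v < D.+1)%N.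
  move=> vA; rewrite ltnS /D -sum1dep_card big_mkcond leq_sum// => i _.
  by have := vp v i vA; case: (p i \isn't a Num.nat) => /=; lia.
pose gI (v : {ffun I -> 'I_H}) : 'I_D.+1 := inord (g v).
rewrite -[D.+1]card_ord -(card_in_imset (f := gI)).
  exact: max_card.
move=> v w vA wA /(congr1 (@nat_of_ord _)); rewrite !inordK ?gD// => gvw.
(* The vertex with the larger shift [t] dominates the other coordinatewise, so equal coordinate sums
   force equality. *)
wlog le_vw : v w vA wA gvw / forall i, (v i <= w i)%N => [wl|].
  have := vA; have := wA; rewrite !inE.
  move=> /kuhn_gt0[s s01 ws] /kuhn_gt0[t t01 vt].
  have [ts|st] := leP t s.
    apply: wl => // i; rewrite -ltnS -(ltr_nat R).
    by move: (ws i) (vt i); lra.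
  apply/esym; apply: wl => // i; rewrite -ltnS -(ltr_nat R).
  by move: (ws i) (vt i); lra.
apply/ffunP => i; apply/val_inj/eqP.
rewrite eqn_leq le_vw /= leqNgt; apply/negP => vw.
move/eqP: gvw; apply/negP; rewrite neq_ltn; apply/orP; left.
rewrite /g (bigD1 i)//= [X in (_ < X)%N](bigD1 i)//= -addSn leq_add//.
  by have := vp v i vA; lia.
by apply: leq_sum => j _; exact: leq_sub2r (le_vw j).
Qed.

End Kuhn.

(** * Partitions of unity with small supports *)

Section SmallPou.
Context {R : realType}.

Lemma continuous_sumr (X : topologicalType) (I : Type) (r : seq I) (P : pred I)
    (F : I -> X -> R) :
  (forall i, continuous (F i)) ->
  continuous (fun x => \sum_(i <- r | P i) F i x).
Proof.
move=> cF x; elim: r => [|i r IH].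
  by under eq_fun do rewrite big_nil; exact: cvg_cst.
under eq_fun do rewrite big_cons.
by case: (P i) => //; apply: cvgD; [exact: cF|exact: IH].
Qed.

Lemma continuous_kuhn (X : topologicalType) (I : finType) (p : I -> X -> R)
    (v : I -> nat) :
  (forall i, continuous (p i)) -> continuous (fun x => kuhn (p ^~ x) v).
Proof.
move=> cp x; apply: cvgB; [apply: continuous_bigmin|apply: continuous_bigmax];
  by move=> i y; apply: cvgB; [exact: cvg_cst|exact: cp].
Qed.

(** The bound [e'] is uniform and strictly below [e], so that suprema of distances over a support
    stay below [e]. *)
Definition small_pou (X : topologicalType) (d : X -> X -> R) (e : R) (D m : nat)
    (phi : 'I_m -> X -> R) : Prop :=
  [/\ forall v, continuous (phi v),
      forall v x, 0 <= phi v x,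
      forall x, \sum_v phi v x = 1,
      forall x, (#|[set v | phi v x != 0%R]%SET| <= D.+1)%N &
      exists2 e', e' < e & forall v x x', phi v x != 0 -> phi v x' != 0 ->
        d x x' <= e'].

(** The functions are normalized Kuhn weights of [s * F]. Since [s] is an integer, integer
    coordinates stay integers and at most [D.+1] weights are positive at a point. Scaled coordinates
    vary by at most 2 on a support, so [2 <= s * t] makes the original ones vary by at most [t]. *)
Lemma cubical_small_pou (X : topologicalType) (d : X -> X -> R) (e : R)
    (D : nat) (I : finType) (F : I -> X -> R) :
  compact [set: X] -> continuous (fun p : X * X => d p.1 p.2) ->
  (forall i, continuous (F i)) -> (forall i x, 0 <= F i x) ->
  (forall x x', (forall i, F i x = F i x') -> d x x' < e) ->
  (forall x, (#|[set i | F i x \isn't a Num.nat]%SET| <= D)%N) ->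
  exists m (phi : 'I_m -> X -> R), small_pou d e D phi.
Proof.
move=> cX cd cF F0 Fd FD.
have [t [e' [t0 e'e] te']] :=
  uniform_fibers cX cd cF (fun x x' _ _ => @Fd x x').
pose s := (Num.truncn (2 / t)).+1.
have st : 2 <= s%:R * t.
  by rewrite -ler_pdivrMr// ltW// truncnS_gt.
pose p i x := s%:R * F i x.
have p0 i x : 0 <= p i x by rewrite mulr_ge0.
have cp i : continuous (p i) by move=> x; apply: cvgM; [exact: cvg_cst|exact: cF].
have [H pH] : exists H, forall i x, (Num.truncn (p i x) < H)%N.
  have [X0|/set0P X0] := eqVneq [set: X] set0.
    by exists 0%N => i x; have : [set: X] x by []; rewrite X0.
  have cM := @continuous_bigmax R _ _ (index_enum I) 0 _ cp.
  have [c _ cmax] := compact_EVT_max X0 cX (continuous_subspaceT cM).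
  exists (Num.truncn (\big[Num.max/0]_i p i c)).+1 => i x.
  rewrite ltnS le_truncn//; apply: le_trans (cmax x _); rewrite ?inE//.
  exact: (@le_bigmax _ _ _ 0 (fun i => p i x)).
pose V := {ffun I -> 'I_H}.
pose beta (v : V) x := Num.max 0 (kuhn (p ^~ x) (fun i => v i : nat)).
have cb v : continuous (beta v).
  move=> x; apply: (@continuous_max R _ (fun=> 0) (fun x => kuhn (p ^~ x) _)).
    exact: cvg_cst.
  exact: continuous_kuhn.
have b0 v x : 0 <= beta v x by rewrite le_max lexx.
have bE v x : (beta v x != 0) = (0 < kuhn (p ^~ x) (fun i => v i : nat)).
  by rewrite -[beta v x != 0]andbT -(b0 v x) -lt0r lt_max ltxx.
(* The sum may be below 1, since vertices with a coordinate at least [H] are left out. The vertex of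
   the floors of [p] is kept, which makes the sum positive. *)
pose tot x := \sum_v beta v x.
have tot0 x : 0 < tot x.
  pose v : V := [ffun i => Ordinal (pH i x)].
  rewrite /tot (bigD1 v)//= ltr_pwDl ?sumr_ge0// lt_max; apply/orP; right.
  rewrite (_ : (fun i => _) = fun i => Num.truncn (p i x)) ?kuhn_truncn_gt0//.
  by apply/funext => i; rewrite ffunE.
exists #|V|, (fun k x => beta (enum_val k) x / tot x).
have phiE k x : (beta (enum_val k) x / tot x != 0) =
    (0 < kuhn (p ^~ x) (fun i => (enum_val k : V) i : nat)).
  by rewrite mulf_eq0 invr_eq0 negb_or (gt_eqF (tot0 x)) andbT bE.
split.
- move=> k x; apply: cvgM; first exact: cb.
  by apply: cvgV; [rewrite gt_eqF|exact: continuous_sumr].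
- by move=> k x; rewrite divr_ge0// ltW.
- move=> x; rewrite -mulr_suml -[RHS](divff (lt0r_neq0 (tot0 x))).
  congr (_ / _).
  by rewrite /tot (reindex _ (onW_bij _ (@enum_val_bij V))).
- move=> x.
  have pN i : p i x \isn't a Num.nat -> F i x \isn't a Num.nat.
    by apply: contra => Fi; rewrite rpredM// natr_nat.
  apply: (@leq_trans #|[set i | p i x \isn't a Num.nat]%SET|.+1); last first.
    rewrite ltnS; apply: leq_trans (FD x); rewrite subset_leq_card//.
    by apply/fintype.subsetP => i; rewrite !inE; exact: pN.
  apply: leq_trans (card_kuhn_gt0 H (p0 ^~ x)).
  rewrite -(card_imset _ enum_val_inj) subset_leq_card//.
  by apply/fintype.subsetP => _ /imsetP[k + ->]; rewrite !inE phiE.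
- exists e' => // k x x'; rewrite !phiE => px px'.
  apply: te' => // i; rewrite -(@ler_pM2l _ s%:R)//.
  have := kuhn_dist i px px'; rewrite -mulrBr normrM normr_nat => /le_trans; exact.
Qed.
End SmallPou.

(** * Bounds on the width dimension *)

Section WidimBounds.
Context {R : realType}.

Lemma continuous_rV (X : topologicalType) (m : nat) (f : X -> 'rV[R]_m) :
  (forall j, continuous (fun x => f x 0 j)) -> continuous f.
Proof.
move=> cf x; apply/cvg_ballP => e e0.
have : \forall y \near x, forall j, ball (f x 0 j) e (f y 0 j).
  apply: filter_forall => j.
  have /cvg_ballP := cf j x; exact.
by apply: filterS => y fy; split => // i j; rewrite ord1.
Qed.

Lemma card_ord_lt (m n : nat) : (n <= m)%N ->
  #|[set i : 'I_m | (i < n)%N]%SET| = n.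
Proof.
move=> nm; rewrite -sum1dep_card (big_ord_narrow nm).
by rewrite sum1_card card_ord.
Qed.

Section Skeleton.
Variables m D : nat.

Lemma skeleton_neq0 (s : {set 'I_m}) :
  s \in [set s : {set 'I_m} | (s != finset.set0) && (#|s| <= D.+1)%N]%SET ->
  s != finset.set0.
Proof. by rewrite inE => /andP[]. Qed.

Lemma skeleton_face (s t : {set 'I_m}) :
  s \in [set s : {set 'I_m} | (s != finset.set0) && (#|s| <= D.+1)%N]%SET ->
  t != finset.set0 -> t \subset s ->
  t \in [set s : {set 'I_m} | (s != finset.set0) && (#|s| <= D.+1)%N]%SET.
Proof.
rewrite !inE => /andP[_ sD] -> ts /=.
exact: leq_trans (subset_leq_card ts) sD.
Qed.

Definition skeleton := SimplicialComplex skeleton_neq0 skeleton_face.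

Lemma skeleton_dim : (D < m)%N -> complex_dim skeleton D.
Proof.
move=> Dm; split => [|s]; last by rewrite inE => /andP[].
exists [set i : 'I_m | (i < D.+1)%N]%SET; last exact: card_ord_lt.
by rewrite inE -card_gt0 card_ord_lt// leqnn.
Qed.

End Skeleton.

(** The [phi v] serve as barycentric coordinates in the [D]-skeleton of a simplex; points with the
    same image share a nonzero coordinate, hence a support. *)
Lemma small_pou_Widim (X : topologicalType) (d : X -> X -> R) (e : R)
    (D m : nat) (phi : 'I_m -> X -> R) :
  0 < e -> small_pou d e D phi -> (Widim d e [set: X] <= D%:R%:E)%E.
Proof.
move=> e0 [cphi phi0 phi1 phiD [e' e'e phid]].
apply: ereal_inf_lbound; exists D => //.
(* padded by zero coordinates, so that the skeleton has dimension D *)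
pose g (x : X) (k : 'I_(m + D.+1)) : R :=
  match fintype.split k with inl v => phi v x | inr _ => 0 end.
pose f x : 'rV[R]_(m + D.+1) := \row_k g x k.
have fE x k : (f x) ord0 k = g x k by rewrite mxE.
have gl x v : g x (lshift _ v) = phi v x by rewrite /g (unsplitK (inl v)).
have gr x v : g x (rshift _ v) = 0 by rewrite /g (unsplitK (inr v)).
exists (m + D.+1)%N, (skeleton _ D), f; split.
  by apply: skeleton_dim; rewrite addnS ltnS leq_addl.
split.
- apply/continuous_subspaceT/continuous_rV => k.
  under eq_fun do rewrite fE /g.
  by case: (fintype.split k) => [v|_]; [exact: cphi|move=> x; exact: cvg_cst].
- move=> x _ /=; split.
  + by move=> k; rewrite fE /g; case: (fintype.split k).
  + under eq_bigr do rewrite fE; rewrite big_split_ord/=.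
    under eq_bigr do rewrite gl; rewrite phi1.
    by rewrite big1 ?addr0// => v _; rewrite gr.
  + rewrite inE; apply/andP; split.
      apply/negP => /eqP s0.
      have : \sum_v phi v x = 0.
        apply: big1 => v _; apply/eqP; apply: contraT => pv.
        suff : lshift D.+1 v \in finset.set0 by rewrite inE.
        by rewrite -s0 inE fE gl.
      by rewrite phi1 => /eqP; rewrite oner_eq0.
    apply: leq_trans (phiD x).
    rewrite -(card_imset _ (@lshift_inj m D.+1)) subset_leq_card//.
    apply/fintype.subsetP => k; rewrite inE fE.
    case: (fintype.splitP k) => j kj; last first.
      by rewrite (_ : k = rshift _ j) ?gr ?eqxx//; apply: val_inj.
    rewrite (_ : k = lshift _ j) ?gl; last exact: val_inj.
    by move=> pj; apply/imsetP; exists j; rewrite ?inE.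
(* The maximum with 0 is there because [diam] is a supremum that includes 0, while [e'] may be
   negative. *)
- move=> z [z0 z1 _]; apply: (@le_lt_trans _ _ (Num.max 0 e')%:E).
    apply: ge_ereal_sup => _ [->|[[x x'] /= [[_ fx] [_ fx']]] <-].
      by rewrite lee_fin le_max lexx.
    rewrite lee_fin le_max; apply/orP; right.
    have [k zk] : exists k, z 0 k != 0.
      apply: contrapT => /forallNP z_eq0.
      suff : \sum_k z 0 k = 0 by rewrite z1 => /eqP; rewrite oner_eq0.
      by apply: big1 => k _; apply/eqP; have /negP := z_eq0 k; rewrite negbK.
    have := zk; rewrite -{1}fx; have := zk; rewrite -{1}fx' !fE /g.
    case: (fintype.split k) => [v px' px|_]; last by rewrite eqxx.
    exact: phid px px'.
  by rewrite lte_fin gt_max e0.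
Qed.

Lemma cubical_Widim (X : topologicalType) (d : X -> X -> R) (e : R)
    (D : nat) (I : finType) (F : I -> X -> R) :
  0 < e -> compact [set: X] -> continuous (fun p : X * X => d p.1 p.2) ->
  (forall i, continuous (F i)) -> (forall i x, 0 <= F i x) ->
  (forall x x', (forall i, F i x = F i x') -> d x x' < e) ->
  (forall x, (#|[set i | F i x \isn't a Num.nat]%SET| <= D)%N) ->
  (Widim d e [set: X] <= D%:R%:E)%E.
Proof.
move=> e0 cX cd cF F0 Fd FD.
have [m [phi]] := cubical_small_pou cX cd cF F0 Fd FD.
exact: small_pou_Widim.
Qed.

(** Stated with [< n.+1] rather than [<= n], so that the infimum directly yields a complex, whose
    integer dimension is then at most [n]. *)
Lemma Widim_embedding (X : topologicalType) (d : X -> X -> R) (e : R)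
    (A : set X) (n : nat) :
  (Widim d e A < n.+1%:R%:E)%E ->
  exists m (f : X -> 'rV[R]_m),
    [/\ {within A, continuous f},
        forall x, A x -> (forall i, 0 <= f x 0 i) /\ \sum_i f x 0 i = 1,
        forall x, A x -> (#|[set i | f x 0%R i != 0%R]%SET| <= n.+1)%N &
        forall x x', A x -> A x' -> f x = f x' -> d x x' < e].
Proof.
move=> /ereal_inf_lt[_ [n' [m [K [f [[_ Kn'] [cf Kf fd]]]]] <-]].
rewrite lte_fin ltr_nat ltnS => n'n; exists m, f; split => //.
- by move=> x /Kf[].
- by move=> x /Kf[_ _ /Kn' le]; apply: leq_trans le _.
- move=> x x' Ax Ax' fxx'; rewrite -lte_fin; apply: le_lt_trans (fd _ (Kf _ Ax)).
  by apply: ereal_sup_ubound; right; exists (x, x').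
Qed.

Lemma sub_Widim (X : topologicalType) (d : X -> X -> R) (e : R)
    (A B : set X) : A `<=` B -> (Widim d e A <= Widim d e B)%E.
Proof.
move=> AB; apply: ereal_inf_le_tmp => _ [n [m [K [f [Kn [cf Kf fd]]]]] <-].
exists n => //; exists m, K, f; split => //; split.
- exact: continuous_subspaceW cf.
- by move=> x /AB/Kf.
- move=> z /fd; apply: le_lt_trans; apply: ereal_sup_le.
  move=> _ [->|[p [[Ap1 p1] [Ap2 p2]]] <-]; first by left.
  by right; exists p => //; split; split => //; exact: AB.
Qed.

Lemma le_Widim (X : topologicalType) (d : X -> X -> R) (e e' : R)
    (A : set X) : e <= e' -> (Widim d e' A <= Widim d e A)%E.
Proof.
move=> ee'; apply: ereal_inf_le_tmp => _ [n [m [K [f [Kn [cf Kf fd]]]]] <-].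
exists n => //; exists m, K, f; split => //; split => // z /fd /lt_le_trans; apply.
by rewrite lee_fin.
Qed.

Lemma Widim_ge0 (X : topologicalType) (d : X -> X -> R) (e : R)
    (A : set X) : (0 <= Widim d e A)%E.
Proof. by apply: le_ereal_inf_tmp => _ [n _ <-]; rewrite lee_fin. Qed.

End WidimBounds.

(** * Extending embeddings of fibers to neighbourhoods *)

Section Fibers.
Context {R : realType}.

(** A tube lemma: [p] is a closed map, and the image of the complement of the interior of [P] misses
    [w]. *)
Lemma near_fiber (Z W : topologicalType) (p : Z -> W) (w : W) (P : Z -> Prop) :
  compact [set: Z] -> hausdorff_space W -> continuous p ->
  (forall z, p z = w -> \forall z' \near z, P z') ->
  \forall w' \near w, forall z, p z = w' -> P z.
Proof.
move=> cZ hW cp nP; pose C := ~` [set z | P z]°.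
have cC : closed (p @` C).
  apply: compact_closed => //; apply: continuous_compact.
    exact: continuous_subspaceT.
  apply: subclosed_compact cZ _ => //; apply: open_closedC; exact: open_interior.
have : nbhs w (~` (p @` C)).
  apply: open_nbhs_nbhs; split; first exact: closed_openC.
  by move=> [z Cz pz]; apply: Cz; exact: nP.
apply: filterS => w' Cw' z pz; apply: contrapT => nPz; apply: Cw'.
by exists z => //= /nbhs_singleton.
Qed.

Lemma hausdorff_prod (T U : topologicalType) :
  hausdorff_space T -> hausdorff_space U -> hausdorff_space (T * U)%type.
Proof.
move=> hT hU [p1 p2] [q1 q2] pq; congr pair.
- apply: hT => A B pA qB; have [||z [[Az _] [Bz _]]] := pq (A `*` setT) (B `*` setT).
  + by exists (A, setT) => //; split => //; exact: filterT.
  + by exists (B, setT) => //; split => //; exact: filterT.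
  + by exists z.1.
- apply: hU => A B pA qB; have [||z [[_ Az] [_ Bz]]] := pq (setT `*` A) (setT `*` B).
  + by exists (setT, A) => //; split => //; exact: filterT.
  + by exists (setT, B) => //; split => //; exact: filterT.
  + by exists z.2.
Qed.

(** The barycentric coordinates on the fiber extend to [X] by Tietze's theorem. Lowering them by [t]
    and cutting at 0 keeps the vanishing ones zero near the fiber; on the fiber, points that become
    equal had coordinates within [t], hence [d < e]. Both properties spread to a neighbourhood of
    [y] by [near_fiber], for [pi] and for its square. *)
Lemma fiber_chart (X Y : topologicalType) (d : X -> X -> R) (e : R)
    (pi : X -> Y) (y : Y) (k : nat) :
  compact [set: X] -> hausdorff_space X -> hausdorff_space Y ->
  continuous (fun p : X * X => d p.1 p.2) -> continuous pi ->
  (Widim d e (pi @^-1` [set y]) < k.+1%:R%:E)%E ->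
  exists (U : set Y) m (g : 'I_m -> X -> R),
    [/\ open_nbhs y U, forall a, continuous (g a), forall a x, 0 <= g a x,
        forall x, U (pi x) -> (#|[set a | g a x != 0%R]%SET| <= k.+1)%N &
        forall x x', U (pi x) -> U (pi x') -> (forall a, g a x = g a x') ->
          d x x' < e].
Proof.
move=> cX hX hY cd cpi; set A := pi @^-1` _.
have clA : closed A.
  by apply: preimage_closed => //; exact/accessible_closed_set1/hausdorff_accessible.
have cA : compact A by exact: subclosed_compact cX _.
move=> /Widim_embedding[m [f [cf f01 fk fd]]].
have : forall a : 'I_m, exists F : X -> R, continuous F /\
    forall x, A x -> F x = f x ord0 a.
  move=> a; have cfa : {within A, continuous (fun x => f x ord0 a : R^o)}.
    move=> x; apply: (@cvg_comp _ _ _ f (fun M : 'rV[R]_m => M ord0 a)).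
      exact: cf.
    exact: coord_continuous.
  have f1 x : A x -> `|f x ord0 a| <= 1.
    move=> Ax; have [f0 f1] := f01 x Ax; rewrite ger0_norm// -f1 (bigD1 a)//=.
    by rewrite lerDl sumr_ge0.
  have [F [FA cF _]] := continuous_bounded_extension
    (compact_normal hX cX) clA ltr01 cfa f1.
  by exists F; split => // x Ax; rewrite FA ?inE.
move=> /choice[F] /all_and2[cF FE].
have [t [e' [t0 e'e] te]] : exists t, exists2 e', 0 < t /\ e' < e &
    forall x x', A x -> A x' -> (forall i, `|F i x - F i x'| <= t) -> d x x' <= e'.
  apply: uniform_fibers => // x x' Ax Ax' FF; apply: fd => //.
  by apply/rowP => a; rewrite -!FE.
pose g a x := Num.max 0 (F a x - t).
have cg a : continuous (g a).
  move=> x; apply: (@continuous_max R _ (fun=> 0) (fun x => F a x - t)).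
    exact: cvg_cst.
  by apply: cvgB; [exact: cF|exact: cvg_cst].
have nU1 : \forall y' \near y, forall x, pi x = y' ->
    (#|[set a | g a x != 0%R]%SET| <= k.+1)%N.
  apply: near_fiber => // x Ax.
  have : \forall x' \near x, forall a, F a x = 0 -> F a x' < t.
    apply: filter_forall => a; have [Fa|Fa] := pselect (F a x = 0); last first.
      by apply: nearW => x' /Fa.
    have : \forall x' \near x, F a x' < t.
      by apply: (cvgr_lt (F a x)); [exact: cF|rewrite Fa].
    by apply: filterS => x' ? _.
  apply: filterS => x' Fx'; apply: leq_trans (fk x Ax); apply: subset_leq_card.
  apply/fintype.subsetP => a; rewrite !inE -FE//; apply: contra => /eqP/Fx' Ft.
  by apply/eqP/max_idPl; rewrite subr_le0 ltW.
have nU2 : \forall q \near (y, y), forall p : X * X, (pi p.1, pi p.2) = q ->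
    (forall a, g a p.1 = g a p.2) -> d p.1 p.2 < e.
  apply: near_fiber.
  - by rewrite -setXTT; exact: compact_setX.
  - exact: hausdorff_prod.
  - move=> p; apply: cvg_pair => /=.
      by apply: continuous_comp; [exact: cvg_fst|exact: cpi].
    by apply: continuous_comp; [exact: cvg_snd|exact: cpi].
  (* A pair with [d] below [e] keeps this nearby; any other pair is separated by some [g a], which
     persists nearby too. *)
  move=> [x x'] /= [Ax Ax']; have [dxx'|dxx'] := ltP (d x x') e.
    have : \forall p \near (x, x'), d p.1 p.2 < e.
      exact: (cvgr_lt (d x x') (cd (x, x'))).
    by apply: filterS => p ? _.
  have [a ga] : exists a, g a x - g a x' != 0.
    apply: contrapT => /forallNP gg; have : d x x' <= e'; last by lra.
    apply: te => // a; have := gg a => /negP; rewrite negbK subr_eq0 => /eqP.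
    have Fx : 0 <= F a x by rewrite FE//; have [] := f01 x Ax.
    have Fx' : 0 <= F a x' by rewrite FE//; have [] := f01 x' Ax'.
    by rewrite ler_norml /g; case: (leP 0 (F a x - t)); case: (leP 0 (F a x' - t)); lra.
  have : \forall p \near (x, x'), g a p.1 - g a p.2 != 0.
    apply: (@cvgr_neq0 _ _ _ (nbhs (x, x')) _ (fun p => g a p.1 - g a p.2) _ _ ga).
    apply: cvgB.
      by apply: continuous_comp; [exact: cvg_fst|exact: cg].
    by apply: continuous_comp; [exact: cvg_snd|exact: cg].
  by apply: filterS => p gp gE; move: gp; rewrite gE subrr eqxx.
have [[U V] [/= nU nV] UV] := nU2.
exists ([set y' | forall x, pi x = y' -> (#|[set a | g a x != 0%R]%SET| <= k.+1)%N]
  `&` (U `&` V))°, m, g; split => //.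
- split; [exact: open_interior|].
  by apply: filterI => //; exact: filterI.
- by move=> a x; rewrite le_max lexx.
- by move=> x /interior_subset[+ _]; exact.
- move=> x x' /interior_subset[_ [Ux _]] /interior_subset[_ [_ Vx']] gxx'.
  exact: (UV (pi x, pi x') (conj Ux Vx') (x, x')).
Qed.
End Fibers.

(** * Sharing out time according to a partition of unity *)

Section Weights.
Context {R : realType}.

(** [clip (a - j)] is the length of the part of [[j, j + 1]] to the left of [a]. *)
Definition clip (a : R) : R := Num.min 1 (Num.max 0 a).

Lemma clip_cases a :
  [\/ a <= 0 /\ clip a = 0, 0 <= a <= 1 /\ clip a = a | 1 <= a /\ clip a = 1].
Proof.
rewrite /clip; have [a0|a0] := leP a 0.
  by constructor 1; rewrite min_r.
have [a1|a1] := leP a 1; first by constructor 2; rewrite ltW.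
by constructor 3; rewrite ltW.
Qed.

Lemma clip_homo : {homo clip : a b / a <= b}.
Proof.
move=> a b ab; case: (clip_cases a) => -[a0 ->];
  by case: (clip_cases b) => -[b0 ->]; lra.
Qed.

Lemma continuous_clip : continuous clip.
Proof.
move=> a; apply: (@continuous_min R R (fun=> 1) (fun a => Num.max 0 a)).
  exact: cvg_cst.
by apply: (@continuous_max R R (fun=> 0) id); [exact: cvg_cst|exact: cvg_id].
Qed.

Variables (m : nat) (phi : 'I_m -> R) (J : nat).
Hypotheses (phi_ge0 : forall v, 0 <= phi v) (phi_sum1 : \sum_v phi v = 1).

Definition cumul (v : nat) : R := \sum_(u < m | (u < v)%N) phi u.

(* The interval [0, J] is cut into consecutive intervals of lengths J * phi v;
   the weight of v at j is the length of the part of [j, j + 1] in the v-th one. *)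
Definition weight (j : nat) (v : nat) : R :=
  clip (J%:R * cumul v.+1 - j%:R) - clip (J%:R * cumul v - j%:R).

Lemma cumul0 : cumul 0 = 0.
Proof. by rewrite /cumul big_pred0. Qed.

Lemma cumulm : cumul m = 1.
Proof. by rewrite -phi_sum1; apply: eq_bigl => u; rewrite ltn_ord. Qed.

Lemma cumulS (v : 'I_m) : cumul v.+1 = cumul v + phi v.
Proof.
rewrite /cumul (bigD1 v) ?ltnSn//= addrC; congr (_ + _).
by apply: eq_bigl => u; rewrite ltnS ltn_neqAle andbC.
Qed.

Lemma cumul_homo u v : (u <= v)%N -> cumul u <= cumul v.
Proof.
move=> uv; rewrite /cumul big_mkcond [leRHS]big_mkcond ler_sum// => w _.
by case: ltnP => wu; case: ltnP => wv//; lia.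
Qed.

Lemma weight_ge0 j v : 0 <= weight j v.
Proof. by rewrite subr_ge0 clip_homo// lerB// ler_wpM2l// cumul_homo. Qed.

Lemma weight_sum1 j : (j < J)%N -> \sum_(v < m) weight j v = 1.
Proof.
move=> jJ; rewrite -(big_mkord xpredT (weight j)) telescope_sumr// cumul0 cumulm.
have : j.+1%:R <= J%:R :> R by rewrite ler_nat.
have : 0 <= j%:R :> R by [].
rewrite -natr1 /weight mulr1 mulr0.
by case: (clip_cases (J%:R - j%:R)) => -[? ->];
  case: (clip_cases (0 - j%:R)) => -[? ->]; lra.
Qed.

Lemma weight_neq0 j (v : 'I_m) : weight j v != 0 -> phi v != 0.
Proof. by apply: contra => /eqP v0; rewrite /weight cumulS v0 addr0 subrr. Qed.

(** If no cut point [J * cumul u] lies strictly between [j] and [j + 1], all clips are 0 or 1.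
    Otherwise the first cut point beyond [j] also lies there, and it ends an interval of positive
    length, so its [phi v] is nonzero. *)
Lemma weight_break j : (exists v, weight j v \isn't a Num.nat) ->
  exists2 v : 'I_m, phi v != 0 & j%:R < J%:R * cumul v.+1 < j.+1%:R.
Proof.
move=> [v wv].
have [u ju] : exists u, j%:R < J%:R * cumul u < j.+1%:R.
  apply: contrapT => nu; move/negP : wv; apply.
  have cl u : clip (J%:R * cumul u - j%:R) = 0 \/ clip (J%:R * cumul u - j%:R) = 1.
    have : ~ (j%:R < J%:R * cumul u < j.+1%:R) by move=> ju; apply: nu; exists u.
    move/negP; rewrite negb_and -!leNgt -natr1 => /orP[cj|cj].
      by left; case: (clip_cases (J%:R * cumul u - j%:R)) => -[? ->]; lra.
    by right; case: (clip_cases (J%:R * cumul u - j%:R)) => -[? ->]; lra.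
  have := weight_ge0 j v; rewrite /weight.
  case: (cl v.+1) => ->; case: (cl v) => ->; rewrite ?subrr ?subr0 ?sub0r//.
  by rewrite oppr_ge0 ler10.
have exu : exists u, j%:R < J%:R * cumul u by exists u; case/andP: ju.
have := ex_minnP exu; case: ex_minnP => -[|w] jw minw _.
  by move: jw; rewrite cumul0 mulr0 ltrn0.
have wj : J%:R * cumul w <= j%:R.
  by rewrite leNgt; apply/negP => /minw; rewrite ltnn.
have wm : (w < m)%N.
  rewrite ltnNge; apply/negP => mw.
  have cE x : (m <= x)%N -> cumul x = 1.
    by move=> mx; rewrite -phi_sum1; apply: eq_bigl => t; rewrite (leq_trans _ mx).
  by move: jw; rewrite ltNge (_ : cumul w.+1 = cumul w) ?wj// !cE// ltnW.
exists (Ordinal wm).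
  apply/negP => /eqP w0; have := cumulS (Ordinal wm); rewrite w0 addr0 => /= E.
  by move: jw; rewrite E ltNge wj.
rewrite /= jw /=; case/andP: ju => ju; apply: le_lt_trans.
by rewrite ler_wpM2l// cumul_homo// minw.
Qed.

(** By [weight_break], each broken [j] has a cut point of the support of [phi] strictly inside
    [[j, j + 1]], and these interiors are disjoint. *)
Lemma card_weight_break :
  (#|[set j : 'I_J | [exists v : 'I_m, weight j v \isn't a Num.nat]]%SET|
     <= #|[set v | phi v != 0%R]%SET|)%N.
Proof.
have [v0 _] : exists v : 'I_m, True.
  case: m phi phi_sum1 => [f|m' _ _]; last by exists ord0.
  by rewrite big_ord0 => /eqP; rewrite eq_sym oner_eq0.
pose P j (v : 'I_m) := phi v != 0 /\ j%:R < J%:R * cumul v.+1 < j.+1%:R.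
have /choice[h hP] : forall j : 'I_J, exists v,
    [exists v : 'I_m, weight j v \isn't a Num.nat] -> P j v.
  move=> j; case: (boolP [exists v : 'I_m, _]) => [/existsP[v wv]|_]; last first.
    by exists v0.
  by have [|u u0 ju] := @weight_break j; [exists v|exists u].
rewrite -(card_in_imset (f := h)).
  apply/subset_leq_card/fintype.subsetP => _ /imsetP[j + ->].
  by rewrite !inE => /hP[].
move=> i j; rewrite !inE => /hP[_ hi] /hP[_ hj] hij; apply/val_inj/eqP => /=.
move: hi hj; rewrite hij => /andP[ih hi] /andP[jh hj].
by rewrite eqn_leq -ltnS -[X in _ && X]ltnS -!(ltr_nat R) (lt_trans ih)// (lt_trans jh).
Qed.

Lemma weight_unbroken j : (j < J)%N ->
  (forall v : 'I_m, weight j v \is a Num.nat) ->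
  exists2 v : 'I_m, weight j v = 1 & forall u : 'I_m, u != v -> weight j u = 0.
Proof.
move=> jJ wN; have [v wv] : exists v : 'I_m, weight j v != 0.
  apply: contrapT => /forallNP w0; have := weight_sum1 jJ; rewrite big1 => [/eqP|v _].
    by rewrite eq_sym oner_eq0.
  by apply/eqP; have /negP := w0 v; rewrite negbK.
have w1 : 1 <= weight j v.
  by move: wv; have /natrP[n ->] := wN v; rewrite pnatr_eq0 -lt0n ler1n.
have := weight_sum1 jJ; rewrite (bigD1 v)//= => wE.
have s0 : \sum_(u < m | u != v) weight j u >= 0.
  by apply: sumr_ge0 => u _; exact: weight_ge0.
exists v; first lra.
have /eqP : \sum_(u < m | u != v) weight j u = 0 by lra.
rewrite psumr_eq0 => [/allP u0 u uv|u _]; last exact: weight_ge0.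
by apply/eqP; have := u0 u; rewrite mem_index_enum uv => /(_ isT).
Qed.

End Weights.

(** * Counting non-integer coordinates *)

Lemma card_set_pair (I J : finType) (P : I -> pred J) :
  #|[set p : I * J | P p.1 p.2]%SET| = (\sum_i #|[set j | P i j]%SET|)%N.
Proof.
rewrite -sum1dep_card -(pair_big_dep xpredT P (fun _ _ => 1%N))/=.
by apply: eq_bigr => i _; rewrite sum1dep_card.
Qed.

(** Outside [B] a single chart has nonzero weight, and that weight is 1, so only its own non-integer
    coordinates count. For [j] in [B] all of [Q] is counted. *)
Lemma card_block_product (R : realType) (J k n : nat) (I Q : finType)
    (tg : Q -> I) (w : 'I_J -> I -> R) (g : 'I_J -> Q -> R) (B : {set 'I_J}) :
  (#|B| <= n)%N ->
  (forall j, j \notin B -> exists2 i, w j i = 1 & forall i', i' != i -> w j i' = 0) ->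
  (forall j i, w j i != 0 ->
    (#|[set q | (tg q == i) && (g j q \isn't a Num.nat)]%SET| <= k)%N) ->
  (#|[set p : 'I_J * Q | (w p.1 (tg p.2) * g p.1 p.2)%R \isn't a Num.nat]%SET|
     <= J * k + n * #|Q|)%N.
Proof.
move=> Bn wB gk.
rewrite (card_set_pair (fun j q => (w j (tg q) * g j q)%R \isn't a Num.nat)).
apply: (@leq_trans (\sum_(j < J) (k + (j \in B) * #|Q|))%N).
  apply: leq_sum => j _; have [jB|jB] := boolP (j \in B).
    by rewrite mul1n; apply: leq_trans (leq_addl _ _); exact: max_card.
  rewrite mul0n addn0; have [i wi wi0] := wB j jB.
  have gki := gk j i; apply: leq_trans (gki _); last by rewrite wi oner_neq0.
  apply/subset_leq_card/fintype.subsetP => q; rewrite !inE.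
  have [->|/wi0 ->] := eqVneq (tg q) i; last by rewrite mul0r nat_num0.
  by rewrite wi mul1r.
rewrite big_split/= sum_nat_const card_ord leq_add2l -big_distrl/= leq_mul2r.
by rewrite -big_mkcond/= sum1_card Bn orbT.
Qed.

(** * The metrics [dyn_dist] and concatenation of time blocks *)

Section Dynamics.
Context {R : realType}.

Lemma continuous_mdist (X : metricType R) :
  continuous (fun p : X * X => mdist p.1 p.2 : R).
Proof.
move=> [x x']; apply/cvgrPdist_lt => e e0 /=.
have e20 : 0 < e / 2 by rewrite divr_gt0.
exists (ball x (e / 2), ball x' (e / 2)).
  by split; apply: nbhsx_ballx.
move=> [y y'] /= []; rewrite !ballEmdist /= => xy x'y'.
have := metric_triangle x y x'; have := metric_triangle y y' x'.
have := metric_triangle y x y'; have := metric_triangle x x' y'.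
rewrite (metric_sym y x) (metric_sym y' x') => t1 t2 t3 t4.
by rewrite ltr_norml; lra.
Qed.

Lemma continuous_iter (X : topologicalType) (T : X -> X) n :
  continuous T -> continuous (iter n T).
Proof.
move=> cT; elim: n => [|n IH] x; first exact: cvg_id.
by apply: (@continuous_comp _ _ _ (iter n T) T); [exact: IH|exact: cT].
Qed.

Lemma continuous_dyn_dist (X : metricType R) (T : X -> X) (N : nat) :
  continuous T -> continuous (fun p : X * X => dyn_dist T N p.1 p.2).
Proof.
move=> cT; apply: continuous_bigmax => n p.
apply: (@continuous_comp _ _ _ (fun p : X * X => (iter n T p.1, iter n T p.2))
  (fun p : X * X => mdist p.1 p.2)); last exact: continuous_mdist.
apply: cvg_pair => /=.
  by apply: continuous_comp; [exact: cvg_fst|exact: continuous_iter].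
by apply: continuous_comp; [exact: cvg_snd|exact: continuous_iter].
Qed.

Lemma dyn_dist_lt (X : metricType R) (T : X -> X) (N : nat) (e : R) x x' :
  0 < e -> (forall n, (n < N)%N -> mdist (iter n T x) (iter n T x') < e) ->
  dyn_dist T N x x' < e.
Proof. by move=> e0 lt; apply/bigmax_ltP; split => // n _; exact: lt. Qed.

Lemma le_dyn_dist (X : metricType R) (T : X -> X) (N n : nat) x x' :
  (n < N)%N -> mdist (iter n T x) (iter n T x') <= dyn_dist T N x x'.
Proof.
move=> nN.
exact: (@le_bigmax _ _ _ 0 (fun i : 'I_N => mdist (iter i T x) (iter i T x'))
  (Ordinal nN)).
Qed.

Lemma dyn_dist_blocks (X : metricType R) (T : X -> X) (N J M : nat) (e : R) x x' :
  0 < e -> (M <= J * N)%N ->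
  (forall j, (j < J)%N ->
    dyn_dist T N (iter (j * N) T x) (iter (j * N) T x') < e) ->
  dyn_dist T M x x' < e.
Proof.
move=> e0 MJN lt; apply: dyn_dist_lt => // n nM.
have nJN : (n < J * N)%N by exact: leq_trans nM MJN.
have N0 : (0 < N)%N by case: N nJN {lt MJN} => //; rewrite muln0.
apply: (@le_lt_trans _ _ (dyn_dist T N (iter (n %/ N * N) T x)
  (iter (n %/ N * N) T x'))); last by apply: lt; rewrite ltn_divLR.
have := @le_dyn_dist X T N (n %% N) (iter (n %/ N * N) T x)
  (iter (n %/ N * N) T x').
by rewrite -!iterD addnC -divn_eq; apply; rewrite ltn_pmod.
Qed.

(** A weak subadditivity in time, by concatenating barycentric coordinates at the times [j * N].
    Counting [n.+1] nonzero coordinates per block instead of the dimension [n] costs 1 per block,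
    negligible after division by a large [N]. *)
Lemma Widim_blocks (X : metricType R) (T : X -> X) (N n J M : nat) (e : R) :
  0 < e -> compact [set: X] -> continuous T ->
  (Widim (dyn_dist T N) e [set: X] < n.+1%:R%:E)%E -> (M <= J * N)%N ->
  (Widim (dyn_dist T M) e [set: X] <= (J * n.+1)%:R%:E)%E.
Proof.
move=> e0 cX cT /Widim_embedding[m [f [cf f01 fn fd]]] MJN.
have {}cf : continuous f by exact: (proj2 (continuous_subspace_setT f) cf).
pose F (p : 'I_J * 'I_m) x := f (iter (p.1 * N) T x) ord0 p.2.
apply: (@cubical_Widim _ _ _ _ _ _ F) => //.
- exact: continuous_dyn_dist.
- move=> p x; apply: (@continuous_comp _ _ _ (fun x => f (iter (p.1 * N) T x))
    (fun M : 'rV[R]_m => M ord0 p.2)); last exact: coord_continuous.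
  apply: (@continuous_comp _ _ _ (iter (p.1 * N) T) f); last exact: cf.
  exact: continuous_iter.
- by move=> p x; have [f0 _] := f01 (iter (p.1 * N) T x) I; exact: f0.
- move=> x x' FE; apply: (dyn_dist_blocks e0 MJN) => j jJ.
  by apply: fd => //; apply/rowP => a; exact: (FE (Ordinal jJ, a)).
- move=> x; rewrite (card_set_pair (fun (j : 'I_J) a =>
    f (iter (j * N) T x) ord0 a \isn't a Num.nat)).
  rewrite -[J in leqRHS]card_ord -sum_nat_const; apply: leq_sum => j _.
  apply: leq_trans (fn (iter (j * N) T x) _) => //; apply/subset_leq_card.
  apply/fintype.subsetP => a; rewrite !inE; apply: contra => /eqP ->.
  exact: nat_num0.
Qed.

Lemma lebesgue_number (Y : metricType R) (I : Type) (U : I -> set Y) :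
  compact [set: Y] -> (forall i, open (U i)) -> (forall y, exists i, U i y) ->
  exists2 eta, 0 < eta & forall y, exists i, forall y', mdist y y' < eta -> U i y'.
Proof.
move=> /compact_near_coveringP cY oU covU.
have : \forall eta \near (0 : R)^'+, [set: Y] `<=`
    [set y | exists i, forall y', mdist y y' < eta -> U i y'].
  apply: cY => y _; have [i Uiy] := covU y.
  have : nbhs y (U i) by exact: open_nbhs_nbhs.
  move=> /nbhs_ballP[r /= r0 rU].
  have r20 : 0 < r / 2 by rewrite divr_gt0.
  exists (ball y (r / 2), [set eta | eta < r / 2]).
    by split => /=; [exact: nbhsx_ballx|exact: nbhs_right_lt].
  move=> [y' eta] /= [yy' etar]; exists i => y'' y'y''; apply: rU.
  move: yy'; rewrite !ballEmdist /= => yy'.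
  by have := metric_triangle y y' y''; lra.
move=> near_eta.
have [eta [/= eta0 etaU]] : exists eta : R, 0 < eta /\ [set: Y] `<=`
    [set y | exists i, forall y', mdist y y' < eta -> U i y'].
  near (0 : R)^'+ => eta; exists eta; split => //.
  by near: eta.
by exists eta => // y; exact: etaU.
Unshelve. all: by end_near. Qed.

End Dynamics.

(** * Width of [X] from the fibers and from [Y] *)

Section Main.
Context {R : realType}.

(* compact_cover is only available on pointed spaces *)
Lemma finite_subcover (Y : topologicalType) (I : choiceType) (U : I -> set Y) :
  compact [set: Y] -> (forall i, open (U i)) -> (forall y, exists i, U i y) ->
  exists s : seq I, forall y, exists2 i, i \in s & U i y.
Proof.
move=> /compact_near_coveringP cY oU covU.
(* The sets [supseq s] generate a filter along which each point is eventually covered, since any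
   sequence containing its index will do. *)
pose supseq (s : seq I) := [set s' : seq I | {subset s <= s'}].
have ff : Filter (filter_from setT supseq).
  apply: filter_from_filter; first by exists [::].
  move=> s s' _ _; exists (s ++ s') => // t st.
  by split=> i si; apply: st; rewrite mem_cat si ?orbT.
have [s _ /(_ s) sU] : (\forall s \near filter_from setT supseq,
    [set: Y] `<=` [set y | exists2 i, i \in s & U i y]).
  apply: cY => y _; have [i Uiy] := covU y.
  exists (U i, supseq [:: i]).
    by split => /=; [exact: open_nbhs_nbhs|exists [:: i]].
  by move=> [y' s] /= [Uiy' si]; exists i => //; apply: si; rewrite mem_head.
by exists s => y; apply: sU.
Qed.

Lemma continuous_weight (Y : topologicalType) (m : nat) (phi : 'I_m -> Y -> R)
    (J j v : nat) :
  (forall v, continuous (phi v)) -> continuous (fun y => weight (phi ^~ y) J j v).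
Proof.
move=> cphi; have cc u : continuous (fun y => clip (J%:R * cumul (phi ^~ y) u - j%:R)).
  move=> y; apply: (@continuous_comp _ _ _
    (fun y => J%:R * cumul (phi ^~ y) u - j%:R) clip); last exact: continuous_clip.
  apply: cvgB; last exact: cvg_cst.
  by apply: cvgM; [exact: cvg_cst|exact: continuous_sumr].
by move=> y; apply: cvgB; exact: cc.
Qed.

Lemma iter_factor (X Y : Type) (T : X -> X) (S : Y -> Y) (pi : X -> Y) n x :
  (forall x, pi (T x) = S (pi x)) -> pi (iter n T x) = iter n S (pi x).
Proof. by move=> piT; elim: n => //= n IH; rewrite piT IH. Qed.

(** For nonempty [X], [eta] is a Lebesgue number of the cover of [Y] by chart domains and [C] the
    number of coordinates of all charts. Both are fixed before [M], so [n.+2 * C] is negligible when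
    [n] is [o(M)]. *)
Lemma factor_Widim (X Y : metricType R) (T : X -> X) (S : Y -> Y) (pi : X -> Y)
    (N k : nat) (e : R) :
  0 < e -> compact [set: X] -> compact [set: Y] ->
  continuous T -> continuous S -> continuous pi ->
  (forall x, pi (T x) = S (pi x)) -> (0 < N)%N ->
  (forall y, (Widim (dyn_dist T N) e (pi @^-1` [set y]) < k.+1%:R%:E)%E) ->
  exists C eta, 0 < eta /\ forall M n, (0 < M)%N ->
    (Widim (dyn_dist S M) eta [set: Y] < n.+1%:R%:E)%E ->
    (Widim (dyn_dist T M) e [set: X]
      <= ((M.-1 %/ N).+1 * k.+1 + n.+2 * C)%N%:R%:E)%E.
Proof.
move=> e0 cX cY cT cS cpi piT N0 Wk.
(* The point [x1] will provide a default chart for the [phi v] that vanish identically. *)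
have [[x1 _]|X0] := pselect (exists x : X, True); last first.
  exists 0%N, 1; split => // M n _ _.
  have nX (x : X) : False by apply: X0; exists x.
  apply: (@cubical_Widim _ _ _ _ _ 'I_0 (fun _ _ => 0)) => //.
  by exact: continuous_dyn_dist.
have : forall y, exists c : set Y * {m : nat & 'I_m -> X -> R},
    [/\ open_nbhs y c.1, forall a, continuous (projT2 c.2 a),
        forall a x, 0 <= projT2 c.2 a x,
        forall x, c.1 (pi x) ->
          (#|[set a | projT2 c.2 a x != 0%R]%SET| <= k.+1)%N &
        forall x x', c.1 (pi x) -> c.1 (pi x') ->
          (forall a, projT2 c.2 a x = projT2 c.2 a x') -> dyn_dist T N x x' < e].
  move=> y; have [U [m [g Ug]]] := fiber_chart cX (@metric_hausdorff _ _)
    (@metric_hausdorff _ _) (@continuous_dyn_dist _ _ _ N cT) cpi (Wk y).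
  by exists (U, existT _ m g).
move=> /choice[c /all_and5[cU cg g0 gk gd]].
pose U y := (c y).1; pose m_ y := projT1 (c y).2.
pose g y : 'I_(m_ y) -> X -> R := projT2 (c y).2.
have [s Us] : exists s : seq Y, forall y, exists2 i, i \in s & U i y.
  by apply: finite_subcover => // y; [have [] := cU y|exists y; have [] := cU y].
pose I := seq_sub s.
have [eta eta0 etaU] : exists2 eta, 0 < eta & forall y, exists i : I,
    forall y', mdist y y' < eta -> U (ssval i) y'.
  apply: lebesgue_number => // [i|y]; first by have [] := cU (ssval i).
  have [i si Ui] := Us y.
  by exists (SeqSub si).
have /choice[ind indU] := etaU.
(* The index [None] adds to each chart the constant coordinate 1, so that the product map [F] also
   records the weight of the chart. *)
pose Q := {i : I & option 'I_(m_ (ssval i))}.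
exists #|{: Q}|, eta; split => // M n M0 /Widim_embedding[b [h [ch h01 hn hd]]].
(* This is [M / N] rounded up: the blocks cover all times below [M], and each starts before [M]. *)
set J := (M.-1 %/ N).+1.
(* The [n.+1] nonzero barycentric coordinates are counted as non-integer ones, so up to [n.+2] of
   the [phi v] are nonzero at a point. *)
have [m [phi [cphi phi0 phi1 phin [eta' eta'eta phid]]]] :
    exists m (phi : 'I_m -> Y -> R), small_pou (dyn_dist S M) eta n.+1 phi.
  apply: (@cubical_small_pou _ _ _ _ _ _ (fun a y => h y ord0 a)) => //.
  - exact: continuous_dyn_dist.
  - move=> a y; apply: (@continuous_comp _ _ _ h (fun M : 'rV[R]_b => M ord0 a)).
      exact: (proj2 (continuous_subspace_setT h) ch).
    exact: coord_continuous.
  - by move=> a y; have [h0 _] := h01 y Logic.I; exact: h0.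
  - by move=> y y' hyy'; apply: hd => //; apply/rowP.
  - move=> y; apply: leq_trans (hn y Logic.I); apply/subset_leq_card/fintype.subsetP.
    by move=> a; rewrite !inE; apply: contra => /eqP ->; exact: nat_num0.
have jN (j : 'I_J) : (j * N < M)%N.
  by rewrite -[M]prednK// ltnS -leq_divRL// -ltnS ltn_ord.
(* As [j * N < M], the image at time [j * N] of the support of [phi v] has distances below [eta], so
   it fits into one chart domain. *)
have : forall p : 'I_m * 'I_J, exists i : I, forall y, phi p.1 y != 0 ->
    U (ssval i) (iter (p.2 * N) S y).
  move=> [v j] /=; have [[y vy]|v0] := pselect (exists y, phi v y != 0).
    exists (ind (iter (j * N) S y)) => y' vy'; apply: indU.
    apply: le_lt_trans (le_dyn_dist _ _ _ (jN j)) _.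
    exact: le_lt_trans (phid v _ _ vy vy') eta'eta.
  by exists (ind (pi x1)) => y vy; case: v0; exists y.
move=> /choice[idx idxU].
pose w (j : 'I_J) i y := \sum_(v | idx (v, j) == i) weight (phi ^~ y) J j v.
have wt0 (j : 'I_J) v y : 0 <= weight (phi ^~ y) J j v by apply: weight_ge0.
have w0 j i y : 0 <= w j i y by apply: sumr_ge0.
have cw j i : continuous (w j i).
  by apply: continuous_sumr => v; exact: continuous_weight.
have w_in (j : 'I_J) i x : w j i (pi x) != 0 -> U (ssval i) (pi (iter (j * N) T x)).
  rewrite psumr_neq0//= => /hasP[v _ /andP[/eqP <- wv]].
  rewrite (iter_factor _ _ piT); apply: (idxU (v, j)) => /=.
  exact: (@weight_neq0 _ _ (phi ^~ (pi x)) J j v (lt0r_neq0 wv)).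
have w_pos j y : exists i, w j i y != 0.
  have [v wv] : exists v : 'I_m, weight (phi ^~ y) J j v != 0.
    apply: contrapT => /forallNP wt_eq0.
    have := @weight_sum1 _ _ _ J (phi1 y) j (ltn_ord j).
    rewrite big1 => [/eqP|v _]; first by rewrite eq_sym oner_eq0.
    by apply/eqP; have /negP := wt_eq0 v; rewrite negbK.
  exists (idx (v, j)); rewrite gt_eqF// /w (bigD1 v)//= ltr_pwDl ?sumr_ge0//.
  by rewrite lt0r wv wt0.
pose G (q : Q) x := if tagged q is Some a then g (ssval (tag q)) a x else 1.
pose F (p : 'I_J * Q) x := w p.1 (tag p.2) (pi x) * G p.2 (iter (p.1 * N) T x).
apply: (@cubical_Widim _ _ _ _ _ _ F) => //.
- exact: continuous_dyn_dist.
- move=> [j [i o]] x; apply: cvgM.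
    by apply: (@continuous_comp _ _ _ pi (w j i)); [exact: cpi|exact: cw].
  rewrite /G /=; case: o => [a|]; last exact: cvg_cst.
  apply: (@continuous_comp _ _ _ (iter (j * N) T) (g _ a)); last exact: cg.
  exact: continuous_iter.
- move=> [j [i o]] x; apply: mulr_ge0; first exact: w0.
  by rewrite /G /=; case: o => [a|]; [exact: g0|].
- move=> x x' FE; apply: (@dyn_dist_blocks _ _ _ N J) => //.
    by rewrite -[M]prednK// /J -ltn_divLR.
  (* The [None] coordinate shows that the weights of chart [i] at [x] and [x'] agree; being nonzero,
     the weight cancels from the other coordinates. *)
  move=> j jJ; have [i wi] := w_pos (Ordinal jJ) (pi x).
  have wE : w (Ordinal jJ) i (pi x) = w (Ordinal jJ) i (pi x').
    by have := FE (Ordinal jJ, existT _ i None); rewrite /F /G /= !mulr1.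
  apply: (gd (ssval i)) => [||a].
  - exact: (w_in (Ordinal jJ)).
  - by apply: (w_in (Ordinal jJ)); rewrite -wE.
  have := FE (Ordinal jJ, existT _ i (Some a)); rewrite /F /G /= -wE.
  exact: mulfI.
- move=> x.
  apply: (@card_block_product _ J k.+1 n.+2 _ _ (fun q : Q => tag q)
    (fun j i => w j i (pi x)) (fun j q => G q (iter (j * N) T x))
    [set j : 'I_J | [exists v : 'I_m,
       weight (phi ^~ (pi x)) J j v \isn't a Num.nat]]%SET).
  + apply: leq_trans (phin (pi x)).
    exact: (@card_weight_break _ _ (phi ^~ (pi x)) J (phi0 ^~ _) (phi1 _)).
  + move=> j; rewrite inE negb_exists => /forallP wN.
    have [v v1 v0] := @weight_unbroken _ _ _ J (phi0 ^~ (pi x)) (phi1 (pi x)) j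
      (ltn_ord j) (fun v => negbNE (wN v)).
    exists (idx (v, j)) => [|i' i'v].
      rewrite /w (bigD1 v)//= v1 big1 ?addr0// => u /andP[_ uv]; exact: v0.
    rewrite /w big1// => u /eqP ui; apply: v0; apply: contraNneq i'v => uv.
    by rewrite -ui uv.
  + move=> j i /w_in Ui; apply: leq_trans (gk _ _ Ui).
    rewrite -(card_imset _ (f := fun a => existT _ i (Some a) : Q)).
      apply/subset_leq_card/fintype.subsetP => -[i' o]; rewrite inE /= => /andP[/eqP ii'].
      move: o; rewrite ii' => -[a|]; last by rewrite nat_num1.
      move=> ga; apply/imsetP; exists a => //; rewrite inE.
      by apply: contra ga => /eqP E; rewrite /G /= /g E nat_num0.
    by move=> a a' /eqP; rewrite -tag_eqE /tag_eq /= eqxx /= tagged_asE => /eqP[].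
Qed.
End Main.

(** * Passage to the limits *)

Section Limits.
Context {R : realType}.

Lemma divn_ereal (x : \bar R) (n : nat) :
  (0 < n)%N -> (x / n%:R%:E = x * (n%:R^-1)%:E)%E.
Proof. by move=> n0; rewrite inver pnatr_eq0 gtn_eqF. Qed.

Lemma lee_divn (x : \bar R) (c : R) (n : nat) :
  (0 < n)%N -> (x / n%:R%:E <= c%:E)%E = (x <= (c * n%:R)%:E)%E.
Proof. by move=> n0; rewrite divn_ereal// lee_pdivrMr ?ltr0n. Qed.

(** A Fekete-type argument with [l] the infimum of [k.+1 / N] over [r N < k.+1]. The hypothesis
    bounds the upper mean growth of [u] by [l], while taking for [k] the integer part of [r n] gives
    [l <= r n / n + 1 / n]. As [r <= u], both means are squeezed to [l]. *)
Lemma mean_cvg (u r : nat -> \bar R) :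
  (forall n, 0 <= r n)%E -> (forall n, r n <= u n)%E ->
  (forall N k c, (0 < N)%N -> (r N < k.+1%:R%:E)%E -> k.+1%:R / N%:R < c ->
    \forall M \near \oo, (u M <= (c * M%:R)%:E)%E) ->
  exists l : \bar R, [/\ (u M / M%:R%:E)%E @[M --> \oo] --> l,
    (r M / M%:R%:E)%E @[M --> \oo] --> l &
    forall c, (l < c%:E)%E -> \forall M \near \oo, (u M <= (c * M%:R)%:E)%E].
Proof.
move=> r0 ru near_u.
pose A := [set (p.2.+1%:R / p.1%:R : R)%:E | p in
  [set p : nat * nat | (0 < p.1)%N /\ (r p.1 < p.2.+1%:R%:E)%E]].
pose l := ereal_inf A; exists l.
have l0 : (0 <= l)%E.
  by apply: le_ereal_inf_tmp => _ [p _ <-]; rewrite lee_fin.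
have upper c : (l < c%:E)%E -> \forall M \near \oo, (u M <= (c * M%:R)%:E)%E.
  move=> /ereal_inf_lt[_ [[N k] /= [N0 rN] <-]]; rewrite lte_fin => kN.
  exact: near_u kN.
have lower n : (0 < n)%N -> (l <= r n / n%:R%:E + (n%:R^-1)%:E)%E.
  move=> n0; have := r0 n; case E : (r n) => [x||]// x0.
    rewrite divn_ereal// -EFinM -EFinD.
    apply: (@le_trans _ _ ((Num.truncn x).+1%:R / n%:R)%:E).
      apply: ereal_inf_lbound; exists (n, Num.truncn x) => //=; split => //.
      by rewrite E lte_fin truncnS_gt.
    rewrite lee_fin -natr1 mulrDl mul1r lerD2r ler_wpM2r//.
    by rewrite truncn_le -lee_fin.
  by rewrite divn_ereal// gt0_mulye ?lte_fin ?invr_gt0 ?ltr0n// addye// leey.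
have le_ru : \forall M \near \oo, (r M / M%:R%:E <= u M / M%:R%:E)%E.
  near=> M; have M0 : (0 < M)%N by near: M; exact: nbhs_infty_gt.
  by rewrite !divn_ereal// lee_wpmul2r ?lee_fin.
have [l_oo|l_fin] := eqVneq l +oo%E.
  have roo : \forall M \near \oo, (r M / M%:R%:E = +oo)%E.
    near=> M; have M0 : (0 < M)%N by near: M; exact: nbhs_infty_gt.
    have := lower M M0; rewrite l_oo leye_eq.
    by case: (r M / M%:R%:E)%E.
  have rl : (r M / M%:R%:E)%E @[M --> \oo] --> l.
    rewrite l_oo; apply/cvgeyPge => c; move: roo.
    by apply: filterS => M ->; rewrite leey.
  split => //; rewrite l_oo; apply/cvgeyPge => c; move: (roo) (le_ru).
  by apply: filterS2 => M -> ru'; apply: le_trans ru'; rewrite leey.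
have lE : l = (fine l)%:E by rewrite fineK// ge0_fin_numE// ltey.
have near_l d : 0 < d -> \forall M \near \oo,
    ((fine l - d)%:E <= r M / M%:R%:E /\ u M / M%:R%:E <= (fine l + d)%:E)%E.
  move=> d0; near=> M.
  have M0 : (0 < M)%N by near: M; exact: nbhs_infty_gt.
  split; last first.
    rewrite lee_divn//; near: M; apply: upper.
    by rewrite {1}lE lte_fin ltrDl.
  have := lower M M0; rewrite lE; case: (r M / M%:R%:E)%E => [x|_|]//=.
    rewrite -EFinD !lee_fin lerBlDr => /le_trans; apply; rewrite lerD2l.
    rewrite invf_ple ?posrE ?ltr0n//; near: M; exact: nbhs_infty_ger.
  by rewrite leey.
have sq (f : nat -> \bar R) :
    (\forall M \near \oo, (r M / M%:R%:E <= f M <= u M / M%:R%:E)%E) ->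
    f M @[M --> \oo] --> l.
  move=> rfu; rewrite lE; apply/fine_cvgP; split.
    have := near_l 1 ltr01; move: rfu; apply: filterS2 => M /andP[rf fu] [lr ul].
    rewrite fin_numE; move: (le_trans lr rf) (le_trans fu ul).
    by case: (f M).
  apply/cvgrPdist_le => d d0; have := near_l d d0; move: rfu.
  apply: filterS2 => M /andP[rf fu] [lr ul].
  move: (le_trans lr rf) (le_trans fu ul); rewrite /=; case: (f M) => //= x.
  by rewrite !lee_fin ler_norml; lra.
split => //; apply: sq; move: le_ru; apply: filterS => M ->; rewrite lexx//.
Unshelve. all: by end_near. Qed.

Lemma lim_right_congr (f g : R -> \bar R) :
  (forall e, 0 < e -> f e = g e) ->
  lim (f e @[e --> (0 : R)^'+]) = lim (g e @[e --> (0 : R)^'+]).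
Proof.
move=> fg; suff -> : f e @[e --> (0 : R)^'+] = g e @[e --> (0 : R)^'+] by [].
have near_fg : {near (0 : R)^'+, f =1 g}.
  by near=> e; apply: fg; near: e; exact: nbhs_right_gt.
apply/seteqP; split => P; first exact: near_eq_cvg near_fg P.
by apply: near_eq_cvg; move: near_fg; apply: filterS => e ->.
Unshelve. all: by end_near. Qed.

Lemma Widim_mean_cvg (Y : metricType R) (S : Y -> Y) (e : R) :
  0 < e -> compact [set: Y] -> continuous S ->
  exists l : \bar R,
    (Widim (dyn_dist S M) e [set: Y] / M%:R%:E)%E @[M --> \oo] --> l /\
    forall c, (l < c%:E)%E -> \forall M \near \oo,
      (Widim (dyn_dist S M) e [set: Y] <= (c * M%:R)%:E)%E.
Proof.
move=> e0 cY cS.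
have [||N k c N0 Wk kc|l [lu _ lc]] := @mean_cvg
  (fun M => Widim (dyn_dist S M) e [set: Y])
  (fun M => Widim (dyn_dist S M) e [set: Y]) => //.
- by move=> n; exact: Widim_ge0.
- near=> M; have M0 : (0 < M)%N by near: M; exact: nbhs_infty_gt.
  apply: le_trans (Widim_blocks (J := (M %/ N).+1) e0 cY cS Wk _) _.
    by rewrite ltnW// -ltn_divLR.
  have MN : (M %/ N)%:R <= M%:R / N%:R :> R.
    by rewrite ler_pdivlMr ?ltr0n// -natrM ler_nat leq_divM.
  rewrite lee_fin natrM -[(M %/ N).+1%:R]natr1.
  (* The cost of the one extra block is absorbed by the slack in [c]. *)
  have : k.+1%:R <= (c - k.+1%:R / N%:R) * M%:R.
    rewrite mulrC -ler_pdivrMr ?subr_gt0//; near: M; exact: nbhs_infty_ger.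
  have : (M %/ N)%:R * k.+1%:R <= M%:R / N%:R * k.+1%:R :> R.
    by rewrite ler_wpM2r.
  by lra.
- by exists l.
Unshelve. all: by end_near. Qed.

(** The mean width is nonincreasing in [e], so its limit at 0 is its supremum over [e > 0]; if that
    is 0, each mean width is at most 0. *)
Lemma mdim0_Widim (Y : metricType R) (S : Y -> Y) (e c : R) :
  compact [set: Y] -> continuous S -> mdim S = 0%E -> 0 < e -> 0 < c ->
  \forall M \near \oo, (Widim (dyn_dist S M) e [set: Y] <= (c * M%:R)%:E)%E.
Proof.
move=> cY cS mS e0 c0.
pose W e M := (Widim (dyn_dist S M) e [set: Y] / M%:R%:E)%E.
pose f e := lim (W e M @[M --> \oo]).
have Wf e' : 0 < e' -> W e' M @[M --> \oo] --> f e'.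
  move=> e'0; have [l [Wl _]] := Widim_mean_cvg e'0 cY cS.
  by apply/cvg_ex; exists l.
have [l [Wl lc]] := Widim_mean_cvg e0 cY cS.
apply: lc; apply: (@le_lt_trans _ _ 0%E); last by rewrite lte_fin.
have -> : l = f e by apply/esym/cvg_lim.
have fsup : f x @[x --> 0^'+] --> ereal_sup (f @` [set` `]0, +oo[ ]).
  apply: nonincreasing_at_right_cvge => // x y; rewrite !in_itv/= !andbT => x0 y0 xy.
  apply: lee_lim; [by apply/cvg_ex; eexists; exact: Wf|
    by apply/cvg_ex; eexists; exact: Wf|].
  near=> M; have M0 : (0 < M)%N by near: M; exact: nbhs_infty_gt.
  by rewrite /W !divn_ereal// lee_wpmul2r ?lee_fin// le_Widim.
have <- : ereal_sup (f @` [set` `]0, +oo[ ]) = 0%E.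
  by rewrite -mS; apply/esym/cvg_lim.
by apply: ereal_sup_ubound; exists e => //=; rewrite in_itv/= e0.
Unshelve. all: by end_near. Qed.

Lemma mean_Widim_factor (X Y : metricType R) (T : X -> X) (S : Y -> Y)
    (pi : X -> Y) (e : R) :
  compact [set: X] -> compact [set: Y] -> continuous T -> continuous S ->
  factor_map T S pi -> mdim S = 0%E -> 0 < e ->
  lim ((Widim (dyn_dist T N) e [set: X] / N%:R%:E)%E @[N --> \oo]) =
  lim ((Defs.ereal_sup0
          [set Widim (dyn_dist T N) e (pi @^-1` [set y]) | y in [set: Y]]
        / N%:R%:E)%E @[N --> \oo]).
Proof.
move=> cX cY cT cS [cpi _ piTS] mS e0.
have piT x : pi (T x) = S (pi x) by have := congr1 (fun h => h x) piTS.
set u := fun N => Widim (dyn_dist T N) e [set: X].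
set r := fun N => Defs.ereal_sup0
  [set Widim (dyn_dist T N) e (pi @^-1` [set y]) | y in [set: Y]].
have [||N k c N0 rk kc|l [ul rl _]] := @mean_cvg u r.
- by move=> n; apply: ereal_sup_ubound; left.
- move=> n; apply: ge_ereal_sup => _ [->|[y _ <-]]; first exact: Widim_ge0.
  exact: sub_Widim.
- have [|C [eta [eta0 WX]]] := @factor_Widim R X Y T S pi N k e e0 cX cY cT cS cpi piT N0.
    move=> y; apply: le_lt_trans rk; apply: ereal_sup_ubound; right.
    by exists y.
  (* Half of the slack [a] absorbs the part [n * C] with [n <= b * M], the other half the constant
     [k.+1 + 2 * C]. Using [C.+1] in [b] avoids division by zero. *)
  set a := c - k.+1%:R / N%:R.
  have a0 : 0 < a by rewrite subr_gt0.
  pose b := a / (2 * C.+1%:R).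
  have b0 : 0 < b by rewrite divr_gt0.
  have bC : b * C%:R <= a / 2.
    rewrite /b invfM mulrA -mulrA ger_pMr ?divr_gt0//.
    by rewrite ler_pdivrMl// mulr1 ler_nat.
  near=> M; have M0 : (0 < M)%N by near: M; exact: nbhs_infty_gt.
  have WS : (Widim (dyn_dist S M) eta [set: Y] <= (b * M%:R)%:E)%E.
    by near: M; exact: mdim0_Widim.
  have bM0 : 0 <= b * M%:R by rewrite mulr_ge0// ltW.
  set n := Num.truncn (b * M%:R).
  have /andP[nb bn] := truncn_itv bM0.
  apply: le_trans (WX M n M0 _) _.
    by apply: le_lt_trans WS _; rewrite lte_fin.
  have MN : (M.-1 %/ N)%:R <= M%:R / N%:R :> R.
    rewrite ler_pdivlMr ?ltr0n// -natrM ler_nat.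
    exact: leq_trans (leq_divM _ _) (leq_pred _).
  rewrite lee_fin natrD !natrM -[(_ %/ _).+1%:R]natr1 -[n.+2%:R]natr1 -[n.+1%:R]natr1.
  have : k.+1%:R + 2 * C%:R <= (a / 2) * M%:R.
    rewrite [leRHS]mulrC -ler_pdivrMr ?divr_gt0//; near: M; exact: nbhs_infty_ger.
  have : (M.-1 %/ N)%:R * k.+1%:R <= M%:R / N%:R * k.+1%:R :> R.
    by rewrite ler_wpM2r.
  have : n%:R * C%:R <= b * M%:R * C%:R by rewrite ler_wpM2r.
  have : b * C%:R * M%:R <= a / 2 * M%:R by rewrite ler_wpM2r.
  by rewrite /a; lra.
- by rewrite (cvg_lim _ ul)// (cvg_lim _ rl).
Unshelve. all: by end_near. Qed.

End Limits.

Theorem theorem1p5 (R : realType) (X Y : metricType R)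
    (T : X -> X) (S : Y -> Y) (pi : X -> Y)
    (hT : dynamical_system T) (hS : dynamical_system S)
    (hpi : factor_map T S pi) (hmdim : mdim S = 0%E) :
  mdim T = rel_mdim T pi.
Proof.
have [cX [_ [cT _ _ _]]] := hT; have [cY [_ [cS _ _ _]]] := hS.
by apply: lim_right_congr => e e0; exact: mean_Widim_factor hpi hmdim e0.
Qed.
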